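(* The following graphs are all strongly RA: 1. the Petersen graph; 2. the cycle graph $C_n$ with $n\ge 5$; 3. every (finite) tree with at least $3$ vertices.
   Context: Graphs are finite, undirected, simple. For a group $G$ and a graph $\Gamma$ with vertices $v_1,\dots,v_n$, $n=|\Gamma|$, and for $g\in G$ and a vertex $v$, let $g^v\in G^n$ be the element with $g$ in each coordinate corresponding to a vertex of the closed neighborhood of $v$ and the identity in all other coordinates. The graph power $G^\Gamma$ is the subgroup of $G^n$ generated by all $g^v$. Commutators are $[x,y]=xyx^{-1}y^{-1}$. Let $\mathrm{Comm}_d(G,\Gamma)$ be the subgroup of $[G^\Gamma,G^\Gamma]$ generated by all $[g^u,h^v]$ with $g,h\in G$ and distinct vertices $u\neq v$ of $\Gamma$. $\Gamma$ is strongly RA if $\mathrm{Comm}_d(G,\Gamma)=[G,G]^{|\Gamma|}$ for every group $G$. *)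

(* Defs.v *)
From HB Require Import structures.
From mathcomp Require Import all_boot.
From mathcomp Require Import boolp classical_sets.

Set Implicit Arguments.
Unset Strict Implicit.
Unset Printing Implicit Defensive.

Local Open Scope classical_set_scope.
Local Open Scope group_scope.

Section Subgroups.
Variable G : groupType.
Implicit Types (S H K : set G) (x y : G).

Definition is_subgroup H : Prop :=
  [/\ H 1,
      forall x y, H x -> H y -> H (x * y) &
      forall x, H x -> H x^-1].

Definition generated S : set G := smallest is_subgroup S.

(* The library's [~ x, y] is the other convention, x^-1 * y^-1 * x * y. *)
Definition commutator x y : G := x * y * x^-1 * y^-1.

Definition commutator_subgroup H K : set G :=
  generated [set z | exists x y, [/\ H x, K y & z = commutator x y]].

End Subgroups.

Record sgraph := SGraph {
  vertex :> finType;
  adj : rel vertex;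
  adj_sym : symmetric adj;
  adj_irrefl : irreflexive adj
}.

Definition closed_nbhd (Gamma : sgraph) (v : Gamma) : pred Gamma :=
  [pred w | (w == v) || adj v w].

(* G^n with its coordinates indexed by the vertices is {ffun Gamma -> G}, a
   groupType under the pointwise operations. *)
Section GraphPower.
Variables (G : groupType) (Gamma : sgraph).
Implicit Types (g h : G) (u v : Gamma).

Definition nbhd_elt g v : {ffun Gamma -> G} :=
  [ffun w => if w \in closed_nbhd v then g else 1].

Definition graph_power : set {ffun Gamma -> G} :=
  generated [set x | exists g v, x = nbhd_elt g v].

Definition Comm_d : set {ffun Gamma -> G} :=
  generated [set x | exists g h u v,
    u != v /\ x = commutator (nbhd_elt g u) (nbhd_elt h v)].

Lemma Comm_d_sub : Comm_d `<=` commutator_subgroup graph_power graph_power.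
Proof.
move=> x xC H [Hgrp Hgen]; apply: xC; split=> // _ [g [h [u [v [_ ->]]]]].
apply: Hgen; exists (nbhd_elt g u), (nbhd_elt h v); split=> //.
  by move=> K [_]; apply; exists g, u.
by move=> K [_]; apply; exists h, v.
Qed.

End GraphPower.

Arguments graph_power : clear implicits.
Arguments Comm_d : clear implicits.

Definition strongly_RA (Gamma : sgraph) : Prop :=
  forall G : groupType,
    Comm_d G Gamma =
    [set f | forall v : Gamma, commutator_subgroup [set: G] [set: G] (f v)].

Local Close Scope classical_set_scope.

(* The Petersen graph as the Kneser graph on the 2-subsets of a 5-set. *)
Definition petersen_vertex : finType := {A : {set 'I_5} | #|A| == 2}.

Definition petersen_adj : rel petersen_vertex :=
  fun A B => [disjoint val A & val B].

Fact petersen_adj_sym : symmetric petersen_adj.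
Proof. by move=> A B; rewrite /petersen_adj disjoint_sym. Qed.

Fact petersen_adj_irrefl : irreflexive petersen_adj.
Proof.
case=> A /= cA; rewrite /petersen_adj -setI_eq0 /= finset.setIid.
by apply/negbTE; rewrite -cards_eq0 (eqP cA).
Qed.

Definition petersen_graph : sgraph :=
  SGraph petersen_adj_sym petersen_adj_irrefl.

(* This is the usual cycle for n >= 3; the conjunct i != j only removes the
   loop that the successor relation would give when n = 1. *)
Definition cycle_adj (n : nat) : rel 'I_n :=
  fun i j => (i != j) &&
    ((i.+1 %% n == j :> nat) || (j.+1 %% n == i :> nat)).

Fact cycle_adj_sym n : symmetric (@cycle_adj n).
Proof. by move=> i j; rewrite /cycle_adj eq_sym orbC. Qed.

Fact cycle_adj_irrefl n : irreflexive (@cycle_adj n).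
Proof. by move=> i; rewrite /cycle_adj eqxx. Qed.

Definition cycle_graph (n : nat) : sgraph :=
  SGraph (@cycle_adj_sym n) (@cycle_adj_irrefl n).

Definition connected_graph (Gamma : sgraph) : Prop :=
  0 < #|Gamma| /\ forall u v : Gamma, connect (@adj Gamma) u v.

(* ucycle also accepts the traversal [:: u; v] of a single edge, so graph cycles
   are the ucycles of size at least 3. *)
Definition acyclic (Gamma : sgraph) : Prop :=
  forall p : seq Gamma, ucycle (@adj Gamma) p -> size p < 3.

Definition is_tree (Gamma : sgraph) : Prop :=
  connected_graph Gamma /\ acyclic Gamma.

(* Main.v *)
Require Import Defs.
From mathcomp Require Import boolp classical_sets.
From mathcomp Require Import all_boot zify.

(** Write k^S for the function equal to k on the vertex set S and to 1 outside
    S.  Commutators in a power of G are taken coordinatewise, so [g^u, h^v] is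
    [g, h]^S with S the intersection of the closed neighbourhoods of u and v.
    Since k |-> k^S is a homomorphism, Comm_d(G, Gamma) contains k^S for every
    such S and every k in [G, G] (Comm_d_spread).  Every element of the power
    of [G, G] is a finite product of elements k^{v}, so it suffices to reach
    all singletons {v} (singletons_strongly_RA).

    The three families share one reason for this: they have no triangle and no
    4-cycle, and each vertex lies on a path with three vertices
    (girth5_strongly_RA).  If v has two neighbours a and b, then the absence of
    short cycles gives N[a] :&: N[b] = {v}.  Otherwise v is a leaf whose
    neighbour w has a second neighbour; then {w} is reached by the previous
    case, N[v] :&: N[w] = {v, w} as there are no triangles, and
    k^{v} = k^{v,w} (k^{w})^-1. *)

Set Implicit Arguments.
Unset Strict Implicit.
Unset Printing Implicit Defensive.

Local Open Scope group_scope.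

(** * Generated subgroups *)

Section Generated.
Variable G : groupType.
Implicit Types (S H : set G).

Lemma generated_subgroup S : is_subgroup (generated S).
Proof.
split; first by move=> H [[]].
  move=> x y Sx Sy H HS; case: (HS) => -[_ HM _] _.
  by apply: HM; [apply: Sx | apply: Sy].
by move=> x Sx H HS; case: (HS) => -[_ _ HV] _; apply: HV; apply: Sx.
Qed.

Lemma sub_generated S x : S x -> generated S x.
Proof. by move=> Sx H [_]; apply. Qed.

Lemma generated_min S H :
  is_subgroup H -> (forall x, S x -> H x) -> forall x, generated S x -> H x.
Proof. by move=> Hgrp SH x; apply; split. Qed.

End Generated.

Notation derived G := (commutator_subgroup [set: G]%classic [set: G]%classic).

Lemma derived_commutator (G : groupType) (g h : G) : derived G (commutator g h).
Proof. by apply: sub_generated; exists g, h. Qed.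

(** * Functions constant on a set of coordinates and trivial elsewhere *)

Section Spread.
Variables (I : finType) (G : groupType).
Implicit Types (S : {pred I}) (k : G) (f : {ffun I -> G}).

Definition spread S k : {ffun I -> G} := [ffun i => if i \in S then k else 1].

Lemma ffun_oneE i : (1 : {ffun I -> G}) i = 1.
Proof. by rewrite ffunE. Qed.

Lemma ffun_mulE f1 f2 i : (f1 * f2) i = f1 i * f2 i.
Proof. by rewrite ffunE. Qed.

Lemma ffun_invE f i : f^-1 i = (f i)^-1.
Proof. by rewrite ffunE. Qed.

Definition ffun_groupE := (ffun_oneE, ffun_mulE, ffun_invE).

Lemma spread1 S : spread S 1 = 1.
Proof. by apply/ffunP=> i; rewrite ffun_oneE ffunE if_same. Qed.

Lemma spreadM S k l : spread S (k * l) = spread S k * spread S l.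
Proof.
by apply/ffunP=> i; rewrite ffun_mulE !ffunE; case: ifP => // _; rewrite mulg1.
Qed.

Lemma spreadV S k : spread S k^-1 = (spread S k)^-1.
Proof.
by apply/ffunP=> i; rewrite ffun_invE !ffunE; case: ifP => // _; rewrite invg1.
Qed.

Lemma eq_spread S1 S2 k : S1 =i S2 -> spread S1 k = spread S2 k.
Proof. by move=> eqS; apply/ffunP=> i; rewrite !ffunE eqS. Qed.

Lemma commutator_spread S1 S2 g h :
  commutator (spread S1 g) (spread S2 h)
  = spread [predI S1 & S2] (commutator g h).
Proof.
apply/ffunP=> i; rewrite /commutator !ffun_groupE !ffunE inE.
by case: (i \in S1); case: (i \in S2);
   rewrite /= ?invg1 ?mulg1 ?mul1g ?mulgV.
Qed.

(** Since [spread S] is a homomorphism, the elements that it sends into [H]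
    form a subgroup. *)
Lemma spread_derived (H : set {ffun I -> G}) S :
  is_subgroup H -> (forall g h, H (spread S (commutator g h))) ->
  forall k, derived G k -> H (spread S k).
Proof.
move=> [H1 HM HV] Hcomm.
apply: (@generated_min _ _ (fun k => H (spread S k))).
  split; first by rewrite spread1.
    by move=> k l Hk Hl; rewrite spreadM; apply: HM.
  by move=> k Hk; rewrite spreadV; apply: HV.
by move=> _ [g [h [_ _ ->]]].
Qed.

(** Such a function is the product of its restrictions to single coordinates;
    the induction adds the coordinates of its support one at a time. *)
Lemma subgroup_from_singletons (H : set {ffun I -> G}) f :
  is_subgroup H -> (forall i, H (spread (pred1 i) (f i))) -> H f.
Proof.
move=> [H1 HM _] Hf.
suff Hs s : uniq s -> H [ffun i => if i \in s then f i else 1].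
  have := Hs (enum I) (enum_uniq I); congr H.
  by apply/ffunP=> i; rewrite ffunE mem_enum.
elim: s => [_|i s IHs /= /andP[i_s uniq_s]].
  suff <- : 1 = [ffun i => if i \in [::] then f i else 1] by [].
  by apply/ffunP=> j; rewrite !ffunE.
have := HM _ _ (Hf i) (IHs uniq_s); congr H.
apply/ffunP=> j; rewrite ffun_mulE !ffunE !inE.
have [->|_] := eqVneq j i; first by rewrite (negPf i_s) mulg1.
by rewrite mul1g.
Qed.

End Spread.

(** * Reduction to single vertices *)

Section CommD.
Variables (G : groupType) (Gamma : sgraph).
Implicit Types (u v w : Gamma) (k : G).

Lemma Comm_d_subgroup : is_subgroup (Comm_d G Gamma).
Proof. exact: generated_subgroup. Qed.

Lemma Comm_d_spread u v (S : {pred Gamma}) k :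
  u != v -> [predI closed_nbhd u & closed_nbhd v] =i S ->
  derived G k -> Comm_d G Gamma (spread S k).
Proof.
move=> uv eqS; apply: spread_derived k; first exact: Comm_d_subgroup.
move=> g h; rewrite -(eq_spread _ eqS) -commutator_spread.
by apply: sub_generated; exists g, h, u, v.
Qed.

(** The families with all coordinates in [derived G] form a subgroup, and the
    coordinates of a generator of [Comm_d] are commutators or trivial. *)
Lemma Comm_d_derived f : Comm_d G Gamma f -> forall v, derived G (f v).
Proof.
have [D1 DM DV] : is_subgroup (derived G) by apply: generated_subgroup.
apply: (@generated_min _ _ (fun f : {ffun Gamma -> G} =>
  forall v, derived G (f v))).
  split=> [v|f1 f2 Df1 Df2 v|f1 Df1 v]; rewrite ffun_groupE //.
    exact: DM.
  exact: DV.
move=> _ [g [h [u [v [_ ->]]]]] w.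
rewrite commutator_spread ffunE.
by case: ifP => // _; apply: derived_commutator.
Qed.

End CommD.

Lemma singletons_strongly_RA (Gamma : sgraph) :
  (forall (G : groupType) (v : Gamma) (k : G),
     derived G k -> Comm_d G Gamma (spread (pred1 v) k)) ->
  strongly_RA Gamma.
Proof.
move=> single G; apply/seteqP; split=> f /=; first exact: Comm_d_derived.
move=> Df; apply: subgroup_from_singletons => [|v].
  exact: Comm_d_subgroup.
exact: single.
Qed.

(** * Graphs without triangles and 4-cycles *)

Definition triangle_free (Gamma : sgraph) : Prop :=
  forall u v w : Gamma, adj u v -> adj v w -> ~~ adj u w.

Definition square_free (Gamma : sgraph) : Prop :=
  forall u v x y : Gamma, u != v ->
    adj u x -> adj v x -> adj u y -> adj v y -> x = y.

(** The vertex [v] lies, as an end or as the middle, on a path with three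
    vertices one edge of which is [v w]. *)
Definition on_path3 (Gamma : sgraph) (v : Gamma) : Prop :=
  exists w z : Gamma, [/\ adj v w, z != v, z != w & adj v z || adj w z].

Section Girth5.
Variable Gamma : sgraph.
Hypotheses (noC3 : triangle_free Gamma) (noC4 : square_free Gamma).
Implicit Types u v w z : Gamma.

(** A further common element would be a second common neighbour, closing a
    4-cycle, or one of [u], [v] themselves, closing a triangle with [x]. *)
Lemma closed_nbhdI_dist2 u v x :
  u != v -> adj u x -> adj v x ->
  [predI closed_nbhd u & closed_nbhd v] =i pred1 x.
Proof.
move=> uv ux vx z; rewrite !inE.
have xv : adj x v by rewrite adj_sym.
have nuv : adj u v = false by apply/negbTE/(noC3 ux xv).
have nvu : adj v u = false by rewrite adj_sym.
have [->|zx] := eqVneq z x; first by rewrite ux vx !orbT.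
apply/negbTE/negP => /andP[/orP[/eqP zu|uz] /orP[/eqP zv|vz]].
- by rewrite -zu -zv eqxx in uv.
- by rewrite zu nvu in vz.
- by rewrite zv nuv in uz.
- by rewrite (noC4 uv uz vz ux vx) eqxx in zx.
Qed.

Lemma closed_nbhdI_adj u v :
  adj u v -> [predI closed_nbhd u & closed_nbhd v] =i pred2 u v.
Proof.
move=> uv z; rewrite !inE.
have [->|zu] := eqVneq z u; first by rewrite [adj v u]adj_sym uv orbT.
have [->|zv] := eqVneq z v; first by rewrite uv.
apply/negbTE/negP => /= /andP[uz vz].
by have := noC3 uv vz; rewrite uz.
Qed.

Lemma girth5_strongly_RA : (forall v, on_path3 v) -> strongly_RA Gamma.
Proof.
move=> path3; apply: singletons_strongly_RA => G v k Dk.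
have inner x a b : a != b -> adj x a -> adj x b ->
    Comm_d G Gamma (spread (pred1 x) k).
  move=> ab xa xb; apply: (Comm_d_spread ab) Dk.
  by apply: closed_nbhdI_dist2; rewrite // adj_sym.
(* If [v] is not known to have two neighbours, then [w] has [v] and [z]. *)
have [w [z [vw zv zw /orP[vz|wz]]]] := path3 v; first exact: inner zw vz vw.
have wv : adj w v by rewrite adj_sym.
have v_neq_w : v != w by apply/eqP=> vw'; rewrite vw' adj_irrefl in vw.
have [_ HM HV] := Comm_d_subgroup G Gamma.
have Dvw := Comm_d_spread v_neq_w (closed_nbhdI_adj vw) Dk.
have := HM _ _ Dvw (HV _ (inner w z v zv wz wv)); congr (Comm_d _ _).
apply/ffunP=> x; rewrite !ffun_groupE !ffunE !inE.
have [->|_] := eqVneq x v; first by rewrite (negPf v_neq_w) invg1 mulg1.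
by case: (x == w); rewrite ?mulgV ?invg1 ?mulg1.
Qed.

End Girth5.

(** * The Petersen graph *)

Lemma disjoint_setU (T : finType) (A B C : {set T}) :
  [disjoint A :|: B & C] = [disjoint A & C] && [disjoint B & C].
Proof. by rewrite !disjoints_subset subUset. Qed.

Lemma card_disjoint (T : finType) (A B : {set T}) :
  [disjoint A & B] -> #|A| + #|B| <= #|T|.
Proof.
rewrite -setI_eq0 => /eqP AB0.
by rewrite -cardsUI AB0 cards0 addn0 max_card.
Qed.

Lemma card_setU_neq (T : finType) (A B : {set T}) :
  #|A| = #|B| -> A != B -> #|A| < #|A :|: B|.
Proof.
move=> cAB; apply: contraNltn => leUA.
have /eqP AUB : A == A :|: B by rewrite eqEcard subsetUl.
have BA : B \subset A by rewrite AUB subsetUr.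
by rewrite eq_sym eqEcard BA cAB leqnn.
Qed.

(** Three pairwise disjoint 2-subsets would need six points. *)
Lemma petersen_triangle_free : triangle_free petersen_graph.
Proof.
move=> [A /= cA] [B /= cB] [C /= cC].
rewrite /petersen_adj /= => AB BC; apply/negP => AC.
have ABC : [disjoint A :|: B & C] by rewrite disjoint_setU AC.
have := card_disjoint ABC; rewrite card_ord (eqP cC).
have := cardsUI A B; move: AB; rewrite -setI_eq0 => /eqP->.
by rewrite cards0 addn0 (eqP cA) (eqP cB) => ->.
Qed.

(** Two distinct 2-subsets cover at least three points, so two distinct
    2-subsets disjoint from both would again require six points. *)
Lemma petersen_square_free : square_free petersen_graph.
Proof.
move=> [U /= cU] [V /= cV] [X /= cX] [Y /= cY].
rewrite /petersen_adj -val_eqE /= => UV UX VX UY VY.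
apply: val_inj => /=; apply/eqP; apply: contraPT isT => XY.
have dUVXY : [disjoint U :|: V & X :|: Y].
  rewrite disjoint_setU ![[disjoint _ & X :|: Y]]disjoint_sym !disjoint_setU.
  by rewrite ![[disjoint X & _]]disjoint_sym ![[disjoint Y & _]]disjoint_sym UX UY VX.
have := card_disjoint dUVXY; rewrite card_ord.
have := card_setU_neq (etrans (eqP cU) (esym (eqP cV))) UV.
have := card_setU_neq (etrans (eqP cX) (esym (eqP cY))) XY.
rewrite (eqP cU) (eqP cX); lia.
Qed.

(** The complement of a 2-subset has three points, hence contains two distinct
    2-subsets. *)
Lemma petersen_on_path3 (v : petersen_graph) : on_path3 v.
Proof.
case: v => A cA.
have : 2 < #|~: A| by rewrite cardsCs finset.setCK card_ord (eqP cA).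
move=> /card_gt2P[a [b [c [[aA bA cA'] [ab bc ca]]]]].
have cab : #|[set a; b]| == 2 by rewrite cards2 ab.
have cac : #|[set a; c]| == 2 by rewrite cards2 [a == c]eq_sym ca.
have disjA x y : x \in ~: A -> y \in ~: A -> [disjoint A & [set x; y]].
  by move=> xA yA; rewrite disjoint_sym disjoints_subset subUset !sub1set xA.
pose w : petersen_graph := Sub [set a; b] cab.
pose z : petersen_graph := Sub [set a; c] cac.
set v : petersen_graph := exist _ A cA.
have vz : adj v z by apply: disjA.
exists w, z; split; last by rewrite vz.
- exact: disjA.
- by apply: contraTneq vz => ->; rewrite adj_irrefl.
- apply/eqP=> /(congr1 val)/= /setP/(_ b).
  by rewrite !inE eqxx orbT eq_sym (negPf ab) (negPf bc).
Qed.

(** * Cycles *)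

(** Each residue is compared with its at most two neighbours in the integers,
    so that linear arithmetic applies. *)
Lemma cycle_adjE n (i j : 'I_n) : 1 < n ->
  adj (i : cycle_graph n) j =
    [|| i.+1 == j :> nat, j.+1 == i :> nat,
        (i == 0 :> nat) && (j.+1 == n) | (j == 0 :> nat) && (i.+1 == n)].
Proof.
move=> n_gt1 /=; rewrite /cycle_adj -val_eqE /=.
have modS (k : 'I_n) : k.+1 %% n = if k.+1 == n then 0 else k.+1.
  case: eqP => [->|k_n]; first by rewrite modnn.
  by rewrite modn_small //; have := ltn_ord k; lia.
rewrite !modS; have := ltn_ord i; have := ltn_ord j.
by case: ifP; case: ifP; lia.
Qed.

Lemma cycle_triangle_free n : 3 < n -> triangle_free (cycle_graph n).
Proof.
move=> n_gt3 [u u_n] [v v_n] [w w_n]; rewrite !cycle_adjE /=; lia.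
Qed.

Lemma cycle_square_free n : 4 < n -> square_free (cycle_graph n).
Proof.
move=> n_gt4 [u u_n] [v v_n] [x x_n] [y y_n].
rewrite !cycle_adjE -?val_eqE /=; try lia.
move=> uv ux vx uy vy; apply: val_inj => /=; lia.
Qed.

Lemma cycle_on_path3 n (v : cycle_graph n) : 2 < n -> on_path3 v.
Proof.
case: v => v v_n n_gt2.
have w_n : (if v.+1 == n then 0 else v.+1) < n by case: ifP; lia.
have z_n : (if v == 0 then n.-1 else v.-1) < n by case: ifP; lia.
exists (Ordinal w_n), (Ordinal z_n).
rewrite !cycle_adjE ?(ltnW n_gt2) // -!val_eqE /=.
by split; do ?case: ifP; lia.
Qed.

(** * Trees *)

Section Trees.
Variable Gamma : sgraph.
Implicit Types u v w : Gamma.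

Lemma adj_neq u v : adj u v -> u != v.
Proof. by apply: contraTneq => ->; rewrite adj_irrefl. Qed.

Lemma acyclic_triangle_free : acyclic Gamma -> triangle_free Gamma.
Proof.
move=> acy u v w uv vw; apply/negP => uw.
suff /acy : ucycle (@adj Gamma) [:: u; v; w] by [].
rewrite /ucycle /= uv vw [adj w u]adj_sym uw !inE.
by rewrite negb_or !adj_neq.
Qed.

Lemma acyclic_square_free : acyclic Gamma -> square_free Gamma.
Proof.
move=> acy u v x y uv ux vx uy vy; apply/eqP; apply: contraPT isT => xy.
suff /acy : ucycle (@adj Gamma) [:: u; x; v; y] by [].
rewrite /ucycle /= ux [adj x v]adj_sym vx vy [adj y u]adj_sym uy !inE.
by rewrite !negb_or uv xy ![x == v]eq_sym !adj_neq.
Qed.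

(** Otherwise [A] would be a union of connected components. *)
Lemma connected_edge_out (A : {pred Gamma}) :
  connected_graph Gamma -> (exists x, x \in A) -> #|A| < #|Gamma| ->
  exists x y, [/\ x \in A, y \notin A & adj x y].
Proof.
move=> [_ conn] [a aA] A_proper; apply: contrapT => no_edge.
have symc : connect_sym (@adj Gamma).
  by move=> u v; rewrite !conn.
have clA : closed (@adj Gamma) A.
  apply: intro_closed => // x y xy xA; apply: contrapT => /negP yA.
  by apply: no_edge; exists x, y.
suff : #|Gamma| <= #|A| by rewrite leqNgt A_proper.
apply/subset_leq_card/subsetP => y _.
by rewrite -(closed_connect clA (conn a y)).
Qed.

(** Two edges suffice: one leaving [v], to [w] say, and one leaving
    [{v, w}]. *)
Lemma connected_on_path3 v :
  connected_graph Gamma -> 2 < #|Gamma| -> on_path3 v.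
Proof.
move=> conn big.
have [||x [w [/eqP-> _ vw]]] := @connected_edge_out (pred1 v) conn.
- by exists v; rewrite inE.
- by rewrite card1 (ltn_trans _ big).
have [||x' [z [x'vw + xz]]] := @connected_edge_out (pred2 v w) conn.
- by exists v; rewrite !inE eqxx.
- by rewrite card2 (leq_ltn_trans _ big) //; case: (_ != _).
rewrite !inE negb_or => /andP[zv zw]; exists w, z; split=> //.
by move: x'vw xz => /orP[/eqP-> ->|/eqP-> ->]; rewrite ?orbT.
Qed.

End Trees.

Theorem corollary5p14 :
  [/\ strongly_RA petersen_graph,
      forall n : nat, 5 <= n -> strongly_RA (cycle_graph n) &
      forall Gamma : sgraph, is_tree Gamma -> 3 <= #|Gamma| -> strongly_RA Gamma].
Proof.
split.
- apply: girth5_strongly_RA; [exact: petersen_triangle_free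
    | exact: petersen_square_free | exact: petersen_on_path3].
- move=> n n_ge5; apply: girth5_strongly_RA => [||v].
  + exact/cycle_triangle_free/ltnW.
  + exact: cycle_square_free.
  + by apply: cycle_on_path3; lia.
- move=> Gamma [conn acy] big; apply: girth5_strongly_RA => [||v].
  + exact: acyclic_triangle_free.
  + exact: acyclic_square_free.
  + exact: connected_on_path3.
Qed.
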